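(* Let $V$ be a finitely generated $\mathcal F$-representation. Then there is a polynomial $\varphi_V(x_0,x_1,x_2,\dots)$ with rational coefficients (in finitely many of the variables $x_0,x_1,x_2,\dots$) such that for every $n>0$ and every endomorphism $f$ of a set of size $n$ (an arbitrary function from the set to itself), the trace of the induced map $Vf$ is $$\operatorname{Tr}(Vf)=\varphi_V(n,a_1,a_2,\dots),$$ where $a_i$ is the number of fixed points of $f^i$, the $i$-th iterate of $f$.
   Context: $\mathcal F$ is the category with objects the finite sets $[k]=\{1,\dots,k\}$, $k\ge 0$, and all functions as morphisms. $\mathcal V$ is the category of finite-dimensional $\mathbb Q$-vector spaces. An $\mathcal F$-representation is a functor $V:\mathcal F\to\mathcal V$; $Vf$ denotes the linear map induced by a function $f$. For $k\ge0$ let $\otimes^k:\mathcal F\to\mathcal V$ be the functor sending $X$ to the free $\mathbb Q$-vector space on the set of functions $[k]\to X$ (with $\mathcal F$ acting by postcomposition). $V$ is finitely generated if there is a surjection onto $V$ from a finite direct sum of functors $\otimes^{k}$ (various $k$). *)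

(* Defs.v *)
From HB Require Import structures.
From mathcomp Require Import all_boot all_order all_algebra.

Set Implicit Arguments.
Unset Strict Implicit.
Unset Printing Implicit Defensive.

Import GRing.Theory.
Local Open Scope ring_scope.

(* The object [k] = {1, ..., k} of the category F is represented by 'I_k;
   finite functions are used as morphisms because they are extensional. *)
Notation fhom m n := {ffun 'I_m -> 'I_n}.

Definition fid n : fhom n n := [ffun x => x].

Definition fcomp m n p (g : fhom n p) (f : fhom m n) : fhom m p :=
  [ffun x => g (f x)].

(* Functors from F to finite-dimensional rational vector spaces. *)
Record Frep := MkFrep {
  Fobj :> nat -> vectType rat;
  Fmap : forall m n : nat, fhom m n -> 'Hom(Fobj m, Fobj n);
  Fmap_id : forall n, Fmap (fid n) = \1%VF;
  Fmap_comp : forall m n p (g : fhom n p) (f : fhom m n),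
    Fmap (fcomp g f) = (Fmap g \o Fmap f)%VF }.

Arguments Fmap V [m n] f : rename.

Definition natural (V W : Frep) (eta : forall n, 'Hom(V n, W n)) : Prop :=
  forall m n (f : fhom m n), (eta n \o Fmap V f = Fmap W f \o eta m)%VF.

Section Tensor.
Variable k : nat.

(* The free vector space on S is {ffun S -> rat^o}. *)
Definition tens_obj n : vectType rat := {ffun fhom k n -> rat^o}.

Definition tens_basis n (g : fhom k n) : tens_obj n :=
  [ffun h => (h == g)%:R].

(* The linear extension of e_g |-> e_(f o g). *)
Definition tens_fun m n (f : fhom m n) (v : tens_obj m) : tens_obj n :=
  \sum_(g : fhom k m) v g *: tens_basis (fcomp f g).

Fact tens_fun_linear m n (f : fhom m n) : linear (tens_fun f).
Proof.
move=> a u v; rewrite /tens_fun scaler_sumr -big_split /=.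
by apply: eq_bigr => g _; rewrite !ffunE scalerDl scalerA.
Qed.

HB.instance Definition _ m n (f : fhom m n) :=
  GRing.isSemilinear.Build rat (tens_obj m) (tens_obj n) _ (tens_fun f)
    (GRing.semilinear_linear (tens_fun_linear f)).

Definition tens_map m n (f : fhom m n) : 'Hom(tens_obj m, tens_obj n) :=
  linfun (tens_fun f).

Lemma tens_fun_basis m n (f : fhom m n) (g : fhom k m) :
  tens_fun f (tens_basis g) = tens_basis (fcomp f g).
Proof.
rewrite /tens_fun (bigD1 g) //= ffunE eqxx scale1r big1 ?addr0 // => h.
by rewrite ffunE => /negPf->; rewrite scale0r.
Qed.

Lemma tens_basis_sum n (v : tens_obj n) :
  v = \sum_(g : fhom k n) v g *: tens_basis g.
Proof.
apply/ffunP=> h; rewrite sum_ffunE (bigD1 h) //= big1 => [|g neq_gh].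
  by rewrite !ffunE eqxx addr0 [RHS]mulr1.
by rewrite !ffunE eq_sym (negPf neq_gh) scaler0.
Qed.

Fact tens_map_id n : tens_map (fid n) = \1%VF.
Proof.
apply/lfunP=> v; rewrite lfunE id_lfunE /= [RHS]tens_basis_sum.
apply: eq_bigr => g _; congr (_ *: tens_basis _).
by apply/ffunP=> i; rewrite !ffunE.
Qed.

Fact tens_map_comp m n p (g : fhom n p) (f : fhom m n) :
  tens_map (fcomp g f) = (tens_map g \o tens_map f)%VF.
Proof.
apply/lfunP=> v; rewrite comp_lfunE !lfunE /= {3}/tens_fun linear_sum.
apply: eq_bigr => h _; rewrite linearZ /= tens_fun_basis.
by congr (_ *: tens_basis _); apply/ffunP=> i; rewrite !ffunE.
Qed.

Definition tens : Frep := MkFrep tens_map_id tens_map_comp.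

End Tensor.

Section ZeroRep.

Definition zero_obj (n : nat) : vectType rat := 'rV[rat]_0.

Definition zero_map m n (f : fhom m n) : 'Hom(zero_obj m, zero_obj n) := 0.

Fact zero_map_id n : zero_map (fid n) = \1%VF.
Proof. by apply/lfunP=> v; apply/rowP=> -[]. Qed.

Fact zero_map_comp m n p (g : fhom n p) (f : fhom m n) :
  zero_map (fcomp g f) = (zero_map g \o zero_map f)%VF.
Proof. by apply/lfunP=> v; apply/rowP=> -[]. Qed.

Definition zero_rep : Frep := MkFrep zero_map_id zero_map_comp.

End ZeroRep.

Section DirectSum.
Variables V W : Frep.

Definition dsum_obj n : vectType rat := (V n * W n)%type.

Definition dsum_fun m n (f : fhom m n) (u : dsum_obj m) : dsum_obj n :=
  (Fmap V f u.1, Fmap W f u.2).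

Fact dsum_fun_linear m n (f : fhom m n) : linear (dsum_fun f).
Proof. by move=> a u v; rewrite /dsum_fun /= !linearP. Qed.

HB.instance Definition _ m n (f : fhom m n) :=
  GRing.isSemilinear.Build rat (dsum_obj m) (dsum_obj n) _ (dsum_fun f)
    (GRing.semilinear_linear (dsum_fun_linear f)).

Definition dsum_map m n (f : fhom m n) : 'Hom(dsum_obj m, dsum_obj n) :=
  linfun (dsum_fun f).

Fact dsum_map_id n : dsum_map (fid n) = \1%VF.
Proof.
apply/lfunP=> -[u v]; rewrite lfunE id_lfunE /= /dsum_fun.
by rewrite !Fmap_id !id_lfunE.
Qed.

Fact dsum_map_comp m n p (g : fhom n p) (f : fhom m n) :
  dsum_map (fcomp g f) = (dsum_map g \o dsum_map f)%VF.
Proof.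
apply/lfunP=> u; rewrite comp_lfunE !lfunE /= /dsum_fun /=.
by rewrite !Fmap_comp !comp_lfunE.
Qed.

Definition dsum : Frep := MkFrep dsum_map_id dsum_map_comp.

End DirectSum.

Definition dsum_tens (ks : seq nat) : Frep :=
  foldr (fun k W => dsum (tens k) W) zero_rep ks.

Definition finitely_generated (V : Frep) : Prop :=
  exists (ks : seq nat) (eta : forall n, 'Hom(dsum_tens ks n, V n)),
    natural eta /\ (forall n, limg (eta n) = fullv).

Definition lfun_trace (U : vectType rat) (h : 'End(U)) : rat :=
  \tr (passmx.mxof (vbasis {:U}) (vbasis {:U}) h).

Definition nfix_iter n (f : fhom n n) (i : nat) : nat :=
  #|[set x : 'I_n | iter i f x == x]|.

(* Main.v *)
Require Import Defs.
From mathcomp Require Import all_boot all_order all_algebra all_fingroup.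
From mathcomp Require Import mpoly.

(** Write chi(f) for the trace of V f, where f is an endomorphism of any finite
    set. Two properties of chi are all that the proof uses ([trace_like]):
    - chi(f o g) = chi(g o f), because traces commute;
    - a finite degree D: if S has at least D elements and x is not in S, then
      the alternating sum over A <= S of chi(f o c_A) is 0, where c_A sends
      every point of A to x and fixes the others. Indeed the alternating sum of
      the V c_A vanishes on each tensor functor of rank k < D, since a function
      g from [k] misses some s in S, and adding s to A does not change c_A o g;
      it therefore vanishes on every quotient of their sum.

    Every such chi is a polynomial in the numbers a_i of fixed points of f^i on
    nonempty sets ([trace_like_fix_poly]), by induction on D. Let f+ be f with
    one more point *, which is fixed. Then chi(f) = chi(f+) - (chi(f+) - chi(f)).
    The difference chi(f+) - chi(f) is trace-like of degree D - 1
    ([trace_like_difference]); here nonemptiness is essential, as the extra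
    point has to be collapsed to a point of the set, and a trace-like function
    of degree 0 vanishes on nonempty sets but perhaps not on the empty one.

    For chi(f+) the fixed point * serves as the point x, and Moebius inversion
    over the subsets of T writes chi(f+) as a sum over S <= T of contributions
    of S. The contribution of S is zero when S has at least D elements, and also
    when f does not map S onto itself; otherwise it depends only on the
    permutation that f induces on S. Numbering the elements of S gives
      chi(f+) = sum_(j < D) 1/j! sum_(tau in S_j) w(tau) #Emb(tau, f),
    where Emb(tau, f) is the set of injections u : [j] -> T such that
    f u = u tau ([chi_omap]).

    Finally #Emb(tau, f) is polynomial in the a_i ([fix_poly_embeddings]): the
    number of all u with f u = u tau is the product of a_l over the cycles of
    tau, l being the length of the cycle ([card_equivariant]), and every u that
    is not injective factors through an embedding of a permutation of fewer
    points, which is covered by induction ([card_equivariant_split]). *)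

Set Implicit Arguments.
Unset Strict Implicit.
Unset Printing Implicit Defensive.

Import Order.TTheory GRing.Theory Num.Theory passmx.
Local Open Scope ring_scope.

(** * Sums over subsets *)

Lemma sum_subsets_setU1 (T : finType) (x : T) (S : {set T}) (F : {set T} -> rat) :
  x \notin S ->
  \sum_(A : {set T} | A \subset x |: S) F A =
  \sum_(A : {set T} | A \subset S) (F A + F (x |: A)).
Proof.
move=> xS; rewrite (bigID (fun A : {set T} => x \in A)) /= addrC big_split /=.
congr (_ + _).
  apply: eq_bigl => A; apply/andP/idP => [[AS xA]|AS].
    by rewrite -(setU1K xS) subsetD1 AS.
  split; first exact: subset_trans AS (subsetUr _ _).
  by apply: contra xS; apply/subsetP.
rewrite (reindex_onto (fun A : {set T} => x |: A) (fun A => A :\ x)) /=; last first.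
  by move=> A /andP[_ xA]; rewrite setD1K.
apply: eq_bigl => A; rewrite setU11 andbT.
apply/andP/idP => [[AS /eqP E]|AS].
  by rewrite -E -(setU1K xS) setSD.
by rewrite setUS // setU1K //; apply: contra xS; apply/subsetP.
Qed.

Lemma sum_subsets_imset (T U : finType) (h : T -> U) (S : {set T}) (F : {set U} -> rat) :
  injective h ->
  \sum_(A : {set U} | A \subset h @: S) F A =
  \sum_(A : {set T} | A \subset S) F (h @: A).
Proof.
move=> h_inj.
rewrite (reindex_onto (fun A : {set T} => h @: A) (fun B => h @^-1: B)) /=; last first.
  move=> B BS; apply/setP => y; apply/imsetP/idP => [[x]|yB].
    by rewrite inE => + ->.
  have /imsetP[x xS Ey] := subsetP BS y yB.
  by exists x; rewrite // inE -Ey.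
apply: eq_bigl => A.
have -> : h @^-1: (h @: A) = A.
  by apply/setP => x; rewrite inE mem_imset.
rewrite eqxx andbT; apply/idP/idP => [hAS|]; last exact: imsetS.
by apply/subsetP => x xA; rewrite -(mem_imset _ _ h_inj) (subsetP hAS) ?imset_f.
Qed.

(** Adding or removing x pairs off the subsets of S with opposite signs. *)
Lemma alt_sum_eq0 (T : finType) (x : T) (S : {set T}) (F : {set T} -> rat) :
  x \in S -> (forall A : {set T}, A \subset S :\ x -> F (x |: A) = F A) ->
  \sum_(A : {set T} | A \subset S) (-1) ^+ #|A| * F A = 0.
Proof.
move=> xS FE; rewrite -(setD1K xS) sum_subsets_setU1 ?setD11 //.
apply: big1 => A AS; rewrite FE // cardsU1.
have -> : x \notin A by apply/negP => /(subsetP AS); rewrite setD11.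
by rewrite exprS mulN1r mulNr subrr.
Qed.

(** Group the pairs (S, A) by C = A u (T \ S): then A ranges over the subsets
    of C, and their signs cancel unless C is empty. *)
Lemma sum_alt_complements (T : finType) (F : {set T} -> rat) :
  \sum_(S : {set T}) \sum_(A : {set T} | A \subset S)
     (-1) ^+ #|A| * F (A :|: ~: S) = F set0.
Proof.
transitivity (\sum_(C : {set T}) \sum_(A : {set T} | A \subset C)
                (-1) ^+ #|A| * F C); last first.
  rewrite (bigD1 set0) //= [X in _ + X]big1 ?addr0 => [|C /set0Pn[x xC]].
    by rewrite (big_pred1 set0) ?cards0 ?mul1r // => A; rewrite subset0.
  exact: (@alt_sum_eq0 _ x).
rewrite (exchange_big_dep predT) //= [RHS](exchange_big_dep predT) //=.
apply: eq_bigr => A _.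
rewrite [RHS](reindex_onto (fun S : {set T} => A :|: ~: S) (fun C => A :|: ~: C)) /=.
  apply: eq_bigl => S; rewrite subsetUl /= setCU setCK.
  by rewrite setUIr setUCr setTI (sameP setUidPr eqP).
move=> C /setUidPr AC.
by rewrite setCU setCK setUIr setUCr setTI.
Qed.

(** A subset of size j is the image of j! injections from [j]. *)
Lemma sum_small_subsets (T : finType) (D : nat) (g : {set T} -> rat) :
  (forall S : {set T}, (D <= #|S|)%N -> g S = 0) ->
  \sum_(S : {set T}) g S =
  \sum_(j < D) (j`!)%:R^-1 *
    \sum_(u : {ffun 'I_j -> T} | injectiveb u) g (u @: [set: 'I_j]).
Proof.
move=> g0.
rewrite (bigID (fun S : {set T} => #|S| < D)%N) /= [X in _ + X]big1 ?addr0; last first.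
  by move=> S; rewrite -leqNgt => /g0.
case: D g0 => [|D] g0; first by rewrite big_ord0 big_pred0.
rewrite (partition_big (fun S : {set T} => inord #|S| : 'I_D.+1) predT) //=.
apply: eq_bigr => j _.
rewrite (partition_big (fun u : {ffun 'I_j -> T} => u @: [set: 'I_j])
           (fun S : {set T} => #|S| == j)) /=; last first.
  by move=> u /injectiveP u_inj; rewrite card_imset // cardsT card_ord.
rewrite mulr_sumr; apply: eq_big => [S|S /andP[SD /eqP Ej]].
  apply/andP/eqP => [[Sj /eqP <-]|->]; first by rewrite inordK.
  by split; rewrite ?ltn_ord // inord_val.
rewrite (eq_bigr (fun=> g S)) => [|u /andP[_ /eqP ->] //].
have Sj : #|S| = j by rewrite -Ej inordK.
rewrite sumr_const.
have -> : #|[pred u : {ffun 'I_j -> T} | injectiveb u && (u @: [set: 'I_j] == S)]| = (j`!)%N.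
  transitivity (#|S| ^_ #|'I_j|); last by rewrite Sj card_ord ffactnn.
  rewrite -card_inj_ffuns_on.
  apply: eq_card => u; rewrite !inE andbC; case: injectiveP => [u_inj|_]; last by rewrite !andbF.
  rewrite !andbT eqEcard card_imset // cardsT card_ord Sj leqnn andbT.
  apply/subsetP/ffun_onP => [uS x|uS _ /imsetP[x _ ->]]; last exact: uS.
  by rewrite uS ?imset_f.
by rewrite -[g S *+ _]mulr_natl mulrA mulVf ?mul1r // pnatr_eq0 -lt0n fact_gt0.
Qed.

(** * Maps that intertwine a permutation and an endo_statction *)

Lemma restrict_perm (T : finType) (f : T -> T) (j : nat) (u : {ffun 'I_j -> T}) :
  injective u -> u @: [set: 'I_j] \subset f @: (u @: [set: 'I_j]) ->
  exists tau : 'S_j, forall i, f (u i) = u (tau i).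
Proof.
move=> u_inj uS.
have ex (i : 'I_j) : exists k, u i == f (u k).
  have u_i : u i \in u @: [set: 'I_j] by rewrite imset_f.
  have /imsetP[_ /imsetP[k _ ->] ->] := subsetP uS _ u_i.
  by exists k.
pose s i := xchoose (ex i).
have sE i : u i = f (u (s i)) by apply/eqP; exact: xchooseP (ex i).
have s_inj : injective s.
  by move=> i k Es; apply: u_inj; rewrite sE Es -sE.
exists (perm s_inj)^-1%g => i.
by rewrite [in RHS]sE -[s _](permE s_inj) permKV.
Qed.

Definition nfix i (T : finType) (f : T -> T) : nat := #|[set x | iter i f x == x]|.

Definition equivariant j (tau : 'S_j) (T : finType) (f : T -> T) :
  {set {ffun 'I_j -> T}} := [set u : {ffun 'I_j -> T} | [forall i : 'I_j, f (u i) == u (tau i)]].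

Lemma equivariantP j (tau : 'S_j) (T : finType) (f : T -> T) (u : {ffun 'I_j -> T}) :
  reflect (forall i : 'I_j, f (u i) = u (tau i)) (u \in equivariant tau f).
Proof. by rewrite inE; apply: (iffP forallP) => H i; apply/eqP. Qed.

Lemma iter_modn (T : Type) (f : T -> T) L x k :
  iter L f x = x -> iter (k %% L) f x = iter k f x.
Proof.
move=> fL; rewrite [in RHS](divn_eq k L) addnC iterD; congr (iter _ _ _).
by elim: (k %/ L)%N => //= q IH; rewrite mulSn iterD -IH fL.
Qed.

(** Both sides depend on a and b modulo the length of the cycle of x only. *)
Lemma iter_porbit_eq (T : finType) (s : {perm T}) x a b (U : Type) (f : U -> U) y :
  iter #|porbit s x| f y = y -> iter a s x = iter b s x -> iter a f y = iter b f y.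
Proof.
move=> fy; rewrite -(iter_modn a (iter_porbit s x)) -(iter_modn b (iter_porbit s x)).
have L0 : (0 < #|porbit s x|)%N by rewrite lt0n card_porbit_neq0.
rewrite -!(nth_traject s (n := #|porbit s x|)) ?ltn_mod // => /eqP.
rewrite nth_uniq ?size_traject ?ltn_mod ?uniq_traject_porbit // => /eqP E.
by rewrite -(iter_modn a fy) -(iter_modn b fy) E.
Qed.

(** An equivariant u is determined by its values at one chosen point r of each
    cycle O, and the value at r can be any point fixed by f^#|O|. *)
Lemma card_equivariant j (tau : 'S_j) (T : finType) (f : T -> T) :
  (0 < #|T|)%N ->
  #|equivariant tau f| = (\prod_(O in porbits tau) nfix #|O| f)%N.
Proof.
move=> /card_gt0P[y0 _].
pose F (O : {set 'I_j}) := [set y | iter #|O| f y == y].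
transitivity #|pfamily y0 (mem (porbits tau)) F|; last first.
  by rewrite card_pfamily foldrE big_map big_enum.
pose r x := odflt x [pick y in porbit tau x].
have r_in x : r x \in porbit tau x.
  by rewrite /r; case: pickP => //= /(_ x); rewrite porbit_id.
have r_eq x y : porbit tau x = porbit tau y -> r x = r y.
  rewrite /r => ->; case: pickP => //= /(_ y); by rewrite porbit_id.
have porbit_r x : porbit tau (r x) = porbit tau x.
  by apply/eqP; rewrite eq_porbit_mem.
pose Phi (u : {ffun 'I_j -> T}) : {ffun {set 'I_j} -> T} :=
  [ffun O => if O \in porbits tau then
               if [pick x in O] is Some x then u x else y0 else y0].
have PhiE u x : Phi u (porbit tau x) = u (r x).
  rewrite ffunE imset_f // /r.
  by case: pickP => //= /(_ x); rewrite porbit_id.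
have equivariant_iter u k x : u \in equivariant tau f -> u (iter k tau x) = iter k f (u x).
  by move=> /equivariantP uE; elim: k => //= k <-; rewrite uE.
(* x is the k x -th iterate of the chosen point of its cycle. *)
pose k x := index x (traject tau (r x) #|porbit tau (r x)|).
have kE x : iter (k x) tau (r x) = x.
  have x_in : x \in traject tau (r x) #|porbit tau (r x)|.
    by rewrite -porbit_traject porbit_r porbit_id.
  rewrite -(nth_traject _ (n := #|porbit tau (r x)|)) ?nth_index //.
  by rewrite -[X in (_ < X)%N](size_traject tau (r x)) index_mem.
rewrite -(card_in_imset (f := Phi)); last first.
  move=> u v uE vE Euv; apply/ffunP => x.
  by rewrite -(kE x) !equivariant_iter // -!PhiE Euv.
apply: eq_card => g; apply/imsetP/pfamilyP => [[u uE ->]|[gD gF]].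
  split.
    by apply/supportP => O ON; rewrite ffunE (negPf ON).
  move=> _ /imsetP[x _ ->]; rewrite PhiE inE -equivariant_iter //.
  by rewrite -(porbit_r x) iter_porbit.
have gfix x : iter #|porbit tau (r x)| f (g (porbit tau x)) = g (porbit tau x).
  have := gF _ (imset_f (porbit tau) (isT : x \in 'I_j)).
  by rewrite inE porbit_r => /eqP.
exists [ffun x => iter (k x) f (g (porbit tau x))].
  apply/equivariantP => x; rewrite !ffunE -iterS.
  have Ep : porbit tau (tau x) = porbit tau x by exact: (porbit_perm tau 1).
  rewrite Ep; apply: (iter_porbit_eq (gfix x)).
  by rewrite iterS kE -(r_eq _ _ Ep) kE.
apply/ffunP => O; have [/imsetP[x _ ->]|ON] := boolP (O \in porbits tau).
  rewrite PhiE ffunE porbit_r.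
  apply: (iter_porbit_eq (a := 0) (gfix x)).
  by have := kE (r x); rewrite (r_eq _ _ (porbit_r x)) => ->.
by rewrite ffunE (negPf ON); apply: (supportP gD _ ON).
Qed.

Definition embeddings j (tau : 'S_j) (T : finType) (f : T -> T) :=
  [set u in equivariant tau f | injectiveb u].

(** An injection whose image is mapped onto itself by f intertwines f with
    exactly one permutation; so a function y of injections that is supported on
    these and depends only on the permutation can be summed by permutation. *)
Lemma sum_restrictions (T : finType) (f : T -> T) (j : nat)
    (y : {ffun 'I_j -> T} -> rat) (x : 'S_j -> rat) :
  (forall (u : {ffun 'I_j -> T}) tau, injective u -> u \in equivariant tau f -> y u = x tau) ->
  (forall u : {ffun 'I_j -> T}, injective u ->
     ~~ (u @: [set: 'I_j] \subset f @: (u @: [set: 'I_j])) -> y u = 0) ->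
  \sum_(u : {ffun 'I_j -> T} | injectiveb u) y u =
  \sum_tau x tau * #|embeddings tau f|%:R.
Proof.
move=> yE y0.
transitivity (\sum_(u : {ffun 'I_j -> T} | injectiveb u)
                \sum_(tau | u \in equivariant tau f) x tau).
  apply: eq_bigr => u /injectiveP u_inj.
  have [uS|uNS] := boolP (u @: [set: 'I_j] \subset f @: (u @: [set: 'I_j])).
    have [tau /equivariantP tauP] := restrict_perm u_inj uS.
    rewrite (big_pred1 tau) ?(yE u tau) // => s.
    apply/idP/eqP => [/equivariantP sP|->//].
    apply/permP => i; apply: u_inj.
    by rewrite -sP; apply/esym/eqP; move/equivariantP: tauP => ->.
  rewrite y0 // big_pred0 // => tau; apply: contraNF uNS => /equivariantP tauP.
  apply/subsetP => _ /imsetP[i _ ->].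
  by rewrite -(permKV tau i) -tauP !imset_f.
rewrite (exchange_big_dep predT) //=; apply: eq_bigr => tau _.
rewrite sumr_const mulr_natr; congr (_ *+ _).
by apply: eq_card => u; rewrite [in RHS]inE andbC.
Qed.

Lemma card_factorizations (T : finType) (f : T -> T) j k (tau : 'S_j)
    (sigma : 'S_k) (i : {ffun 'I_k -> T}) :
  injective i -> i \in equivariant sigma f ->
  #|[set u in equivariant tau f | u @: [set: 'I_j] == i @: [set: 'I_k]]| =
  #|[set q in equivariant tau sigma | q @: [set: 'I_j] == [set: 'I_k]]|.
Proof.
move=> i_inj /equivariantP iE.
pose comp_i (q : {ffun 'I_j -> 'I_k}) := [ffun x => i (q x)] : {ffun 'I_j -> T}.
have im_comp q : comp_i q @: [set: 'I_j] = i @: (q @: [set: 'I_j]).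
  by rewrite -imset_comp; apply: eq_imset => x; rewrite ffunE.
rewrite -[RHS](card_imset (f := comp_i)); last first.
  by move=> q r E; apply/ffunP => x; apply: i_inj; move/ffunP/(_ x): E; rewrite !ffunE.
apply: eq_card => u; rewrite inE; apply/andP/imsetP.
  case=> /equivariantP uE /eqP im_u.
  have ex x : exists y, u x == i y.
    have : u x \in u @: [set: 'I_j] by rewrite imset_f.
    by rewrite im_u => /imsetP[y _ ->]; exists y.
  pose q := [ffun x => xchoose (ex x)].
  have qE x : i (q x) = u x by rewrite ffunE; apply/esym/eqP; exact: xchooseP (ex x).
  have uq : u = comp_i q by apply/ffunP => x; rewrite ffunE qE.
  exists q => //; rewrite inE; apply/andP; split.
    by apply/equivariantP => x; apply: i_inj; rewrite -iE !qE uE.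
  by move/eqP: im_u; rewrite uq im_comp (inj_eq (imset_inj i_inj)).
case=> q; rewrite inE => /andP[/equivariantP qE /eqP im_q] ->; split.
  by apply/equivariantP => x; rewrite !ffunE iE qE.
by rewrite im_comp im_q.
Qed.

(** * Polynomials in the numbers of fixed points of iterates *)

Definition endo_stat := forall T : finType, (T -> T) -> rat.

(** Functions are compared on nonempty sets only, since a representation can be
    changed at the empty set without changing the traces elsewhere. *)
Inductive fix_poly : endo_stat -> Prop :=
  | FixPolyConst c : fix_poly (fun _ _ => c)
  | FixPolyVar i : fix_poly (fun T f => (nfix i.+1 f)%:R)
  | FixPolyAdd F G :
      fix_poly F -> fix_poly G -> fix_poly (fun T f => F T f + G T f)
  | FixPolyMul F G :
      fix_poly F -> fix_poly G -> fix_poly (fun T f => F T f * G T f)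
  | FixPolyEq F G :
      (forall (T : finType) (f : T -> T), (0 < #|T|)%N -> F T f = G T f) ->
      fix_poly F -> fix_poly G.

Lemma fix_poly_sum (I : Type) (r : seq I) (P : pred I) (F : I -> endo_stat) :
  (forall i, P i -> fix_poly (F i)) ->
  fix_poly (fun T f => \sum_(i <- r | P i) F i T f).
Proof.
move=> FP; elim: r => [|i r IH].
  by apply: FixPolyEq (FixPolyConst 0) => T f _; rewrite big_nil.
have [Pi|PNi] := boolP (P i).
  by apply: FixPolyEq (FixPolyAdd (FP i Pi) IH) => T f _; rewrite big_cons Pi.
by apply: FixPolyEq IH => T f _; rewrite big_cons (negPf PNi).
Qed.

Lemma fix_poly_prod (I : Type) (r : seq I) (P : pred I) (F : I -> endo_stat) :
  (forall i, P i -> fix_poly (F i)) ->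
  fix_poly (fun T f => \prod_(i <- r | P i) F i T f).
Proof.
move=> FP; elim: r => [|i r IH].
  by apply: FixPolyEq (FixPolyConst 1) => T f _; rewrite big_nil.
have [Pi|PNi] := boolP (P i).
  by apply: FixPolyEq (FixPolyMul (FP i Pi) IH) => T f _; rewrite big_cons Pi.
by apply: FixPolyEq IH => T f _; rewrite big_cons (negPf PNi).
Qed.

Lemma fix_poly_equivariant j (tau : 'S_j) :
  fix_poly (fun T f => #|equivariant tau f|%:R).
Proof.
apply: (@FixPolyEq (fun T f => \prod_(O in porbits tau) (nfix #|O| f)%:R)).
  by move=> T f T0; rewrite card_equivariant // natr_prod.
apply: fix_poly_prod => _ /imsetP[x _ ->].
rewrite -(prednK (n := #|porbit tau x|)) ?lt0n ?card_porbit_neq0 //.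
exact: FixPolyVar.
Qed.

(** An equivariant u with k < j image points is i o q for a surjection q onto
    [k] and an injection i. Since f o u = u o tau has the same image as u, f
    permutes this image, and so i intertwines f with a permutation sigma of [k];
    each u arises from k! choices of i. *)
Lemma card_equivariant_split j (tau : 'S_j) (T : finType) (f : T -> T) :
  #|equivariant tau f|%:R = #|embeddings tau f|%:R +
  \sum_(k < j) (k`!)%:R^-1 * \sum_(sigma : 'S_k)
     #|[set q in equivariant tau sigma | q @: [set: 'I_j] == [set: 'I_k]]|%:R *
     #|embeddings sigma f|%:R :> rat.
Proof.
(* The number of equivariant maps with image S, for S too small for them to be
   injective. *)
pose g (S : {set T}) : rat := if (#|S| < j)%N then
  #|[set u in equivariant tau f | u @: [set: 'I_j] == S]|%:R else 0.
transitivity (#|embeddings tau f|%:R + \sum_(S : {set T}) g S); last first.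
  congr (_ + _); rewrite (@sum_small_subsets _ j) => [|S]; last first.
    by rewrite /g leqNgt => /negPf->.
  apply: eq_bigr => k _; congr (_ * _); apply: sum_restrictions => u.
    move=> sigma u_inj uE; rewrite /g card_imset // cardsT card_ord ltn_ord.
    by rewrite (card_factorizations tau u_inj uE).
  move=> u_inj uNS; rewrite /g; case: ifP => // _.
  rewrite (_ : [set _ in _ | _] = set0) ?cards0 //.
  apply/setP => v; rewrite inE in_set0; apply: contraNF uNS.
  move=> /andP[/equivariantP vE /eqP<-].
  apply/subsetP => _ /imsetP[i _ ->].
  by rewrite -(permKV tau i) -vE !imset_f.
rewrite -big_mkcond /= -natr_sum -natrD; congr (_%:R).
rewrite -(cardsID [set u : {ffun 'I_j -> T} | injectiveb u] (equivariant tau f)); congr (_ + _)%N.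
  by apply: eq_card => u; rewrite !inE.
rewrite -sum1_card (partition_big (fun u : {ffun 'I_j -> T} => u @: [set: 'I_j])
  (fun S : {set T} => #|S| < j)%N) /=.
  apply: eq_bigr => S Sj; rewrite -sum1_card; apply: eq_bigl => u.
  rewrite !inE; case: eqP => [Su|_]; last by rewrite !andbF.
  have [u_inj|_] := injectiveP u; last by rewrite !andbT.
  by rewrite -Su card_imset // cardsT card_ord ltnn in Sj.
move=> u; rewrite !inE => /andP[uNinj _].
have cardT : #|[set: 'I_j]| = j by rewrite cardsT card_ord.
rewrite ltn_neqAle -[X in (_ <= X)%N]cardT leq_imset_card andbT.
apply: contra uNinj => /eqP E; apply/injectiveP.
have /imset_injP u_inj : #|u @: [set: 'I_j]| == #|[set: 'I_j]| by rewrite E cardT.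
by move=> x y; apply: u_inj; rewrite inE.
Qed.

Lemma fix_poly_embeddings j (tau : 'S_j) :
  fix_poly (fun T f => #|embeddings tau f|%:R).
Proof.
elim/ltn_ind: j tau => j IH tau.
pose lower : endo_stat := fun T f =>
  \sum_(k < j) (k`!)%:R^-1 * \sum_(sigma : 'S_k)
     #|[set q in equivariant tau sigma | q @: [set: 'I_j] == [set: 'I_k]]|%:R *
     #|embeddings sigma f|%:R.
apply: (@FixPolyEq (fun T f => #|equivariant tau f|%:R + (-1) * lower T f)).
  by move=> T f _; rewrite card_equivariant_split mulN1r addrK.
apply: FixPolyAdd; first exact: fix_poly_equivariant.
apply: FixPolyMul; first exact: FixPolyConst.
apply: fix_poly_sum => k _; apply: FixPolyMul; first exact: FixPolyConst.
apply: fix_poly_sum => sigma _; apply: FixPolyMul; first exact: FixPolyConst.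
exact: IH.
Qed.

(** Allowing every large enough number of variables puts two polynomials over
    the same ring without renaming variables. *)
Lemma fix_poly_mpoly (F : endo_stat) : fix_poly F ->
  exists N0, forall N, (N0 <= N)%N -> exists phi : {mpoly rat[N.+1]},
    forall n (f : 'I_n -> 'I_n), (0 < n)%N ->
      F 'I_n f = phi.@[fun i : 'I_N.+1 =>
                         if val i == 0%N then n%:R else (nfix i f)%:R].
Proof.
elim=> {F} [c|i|F G _ [N1 IH1] _ [N2 IH2]|F G _ [N1 IH1] _ [N2 IH2]|F G FG _ [N0 IH]].
- by exists 0%N => N _; exists c%:MP => n f _; rewrite mevalC.
- exists i.+1 => N iN; exists 'X_(inord i.+1) => n f _.
  by rewrite mevalXU /= inordK.
- exists (maxn N1 N2) => N; rewrite geq_max => /andP[/IH1[p pE] /IH2[q qE]].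
  by exists (p + q) => n f n0; rewrite mevalD pE // qE.
- exists (maxn N1 N2) => N; rewrite geq_max => /andP[/IH1[p pE] /IH2[q qE]].
  by exists (p * q) => n f n0; rewrite mevalM pE // qE.
exists N0 => N /IH[p pE]; exists p => n f n0.
by rewrite -FG ?card_ord // pE.
Qed.

(** * Trace-like functions *)

Definition collapse (T : finType) (A : {set T}) (x t : T) : T :=
  if t \in A then x else t.

(** The degree condition is that of the trace on a quotient of tensor functors
    of rank less than D, expressed without the representation. *)
Record trace_like (D : nat) (chi : endo_stat) : Prop := TraceLike {
  chi_ext : forall (T : finType) (f g : T -> T), f =1 g -> chi T f = chi T g;
  chi_comm : forall (T U : finType) (f : T -> U) (g : U -> T),
    chi U (f \o g) = chi T (g \o f);
  chi_vanish : forall (T : finType) (f : T -> T) (S : {set T}) (x : T),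
    x \notin S -> (D <= #|S|)%N ->
    \sum_(A : {set T} | A \subset S)
       (-1) ^+ #|A| * chi T (f \o collapse A x) = 0 }.

(** Collapsing A to the added point, which serves as base point. *)
Definition kill (T : finType) (A : {set T}) : option T -> option T :=
  collapse (Some @: A) None.

Lemma killE (T : finType) (A : {set T}) t :
  kill A (Some t) = if t \in A then None else Some t.
Proof. by rewrite /kill /collapse mem_imset //; apply: Some_inj. Qed.

Lemma kill_None (T : finType) (A : {set T}) : kill A None = None.
Proof. by rewrite /kill /collapse; case: ifP. Qed.

(** For an injection of [j] with image S, the contribution of S to the trace is
    [weight] of the map that f induces on [j] with a base point. *)
Definition weight (chi : endo_stat) (j : nat) (g : option 'I_j -> option 'I_j) : rat :=
  \sum_(A : {set 'I_j}) (-1) ^+ #|A| * chi (option 'I_j) (g \o kill A).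

(** The left inverse of u between pointed sets. *)
Definition retract (T : finType) j (u : {ffun 'I_j -> T}) : option T -> option 'I_j :=
  obind (fun t => [pick i | u i == t]).

Lemma retractK (T : finType) j (u : {ffun 'I_j -> T}) i :
  injective u -> retract u (Some (u i)) = Some i.
Proof.
move=> u_inj; rewrite /retract /=; case: pickP => [k /eqP /u_inj -> //|/(_ i)].
by rewrite eqxx.
Qed.

Lemma retract_Some (T : finType) j (u : {ffun 'I_j -> T}) t i :
  retract u (Some t) = Some i -> t = u i.
Proof. by rewrite /retract /=; case: pickP => // k /eqP <- [->]. Qed.

Lemma chi_kill_eq0 D (chi : endo_stat) (T : finType) (g : option T -> option T) (S : {set T}) :
  trace_like D chi -> (D <= #|S|)%N ->
  \sum_(A : {set T} | A \subset S) (-1) ^+ #|A| * chi (option T) (g \o kill A) = 0.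
Proof.
move=> chiP DS; have Some_inj' : injective (@Some T) by apply: Some_inj.
transitivity (\sum_(B : {set option T} | B \subset Some @: S)
                (-1) ^+ #|B| * chi (option T) (g \o collapse B None)).
  rewrite sum_subsets_imset //; apply: eq_bigr => A _.
  by rewrite card_imset.
apply: (chi_vanish chiP); last by rewrite card_imset.
by apply/imsetP => -[].
Qed.

(** Moving [kill A] to the left of g by commutation, whether i lies in A no
    longer matters, so the alternating sum cancels. Hence only those g whose
    values include all of [j] contribute, and for a pointed g this means that
    it permutes [j]. *)
Lemma weight_missing D (chi : endo_stat) j (g : option 'I_j -> option 'I_j) i :
  trace_like D chi -> (forall x, g x != Some i) -> weight chi g = 0.
Proof.
move=> chiP gi; rewrite /weight.
transitivity (\sum_(A : {set 'I_j} | A \subset [set: 'I_j])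
               (-1) ^+ #|A| * chi (option 'I_j) (kill A \o g)).
  by apply: eq_big => [A|A _]; [rewrite subsetT | rewrite (chi_comm chiP)].
apply: (@alt_sum_eq0 _ i); first by rewrite inE.
move=> A _; apply: (chi_ext chiP) => x /=.
have := gi x; case: (g x) => [k|]; last by rewrite !kill_None.
by rewrite !killE !inE => ki; have /negPf -> : k != i by apply: contra ki => /eqP->.
Qed.

(** Killing A together with the complement of S factors through the pointed
    set [j] numbering S; commuting the two factors transports the trace there. *)
Lemma sum_kill_weight D (chi : endo_stat) (T : finType) (f : T -> T) j (u : {ffun 'I_j -> T}) :
  trace_like D chi -> injective u ->
  let S := u @: [set: 'I_j] in
  \sum_(A : {set T} | A \subset S)
     (-1) ^+ #|A| * chi (option T) (omap f \o kill (A :|: ~: S)) =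
  weight chi (retract u \o omap (f \o u)).
Proof.
move=> chiP u_inj S; rewrite /S sum_subsets_imset // /weight.
apply: eq_big => [A|A _]; first by rewrite subsetT.
rewrite card_imset //; congr (_ * _).
transitivity (chi (option T) ((omap (f \o u) \o kill A) \o retract u)).
  apply: (chi_ext chiP) => -[t|] /=; last by rewrite !kill_None.
  rewrite killE !inE; have [/imsetP[i _ ->]|tS] := boolP (t \in u @: [set: 'I_j]).
    rewrite -[[pick _ | _]]/(retract u (Some (u i))) retractK // killE.
    by rewrite mem_imset //= orbF; case: ifP.
  rewrite orbT; case: pickP => [i /eqP Et|_]; last by rewrite kill_None.
  by rewrite -Et imset_f in tS.
by rewrite (chi_comm chiP); apply: (chi_ext chiP).
Qed.

Lemma chi_omap D (chi : endo_stat) (T : finType) (f : T -> T) :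
  trace_like D chi ->
  chi (option T) (omap f) =
  \sum_(j < D) (j`!)%:R^-1 *
    \sum_(tau : 'S_j) weight chi (omap tau) * #|embeddings tau f|%:R.
Proof.
move=> chiP.
pose F (C : {set T}) := chi (option T) (omap f \o kill C).
transitivity (F set0).
  by apply: (chi_ext chiP) => -[t|] /=; rewrite ?killE ?kill_None // inE.
rewrite -sum_alt_complements (@sum_small_subsets _ D) => [|S DS]; last first.
  rewrite -[RHS](chi_kill_eq0 (omap f \o kill (~: S)) chiP DS).
  apply: eq_bigr => A _; congr (_ * _); apply: (chi_ext chiP) => -[t|] /=.
    rewrite !killE in_setU; case: (t \in A) => /=; first by rewrite kill_None.
    by rewrite killE.
  by rewrite !kill_None.
apply: eq_bigr => j _; congr (_ * _); apply: sum_restrictions => u.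
  move=> tau u_inj /equivariantP uE; rewrite (sum_kill_weight _ chiP) //.
  apply: eq_bigr => A _; congr (_ * _); apply: (chi_ext chiP) => o /=.
  by case: (kill A o) => //= i; rewrite uE -[[pick _ | _]]/(retract u (Some (u (tau i)))) retractK.
move=> u_inj /subsetPn[_ /imsetP[i _ ->] iN]; rewrite (sum_kill_weight _ chiP) //.
apply: (@weight_missing D _ _ _ i) => // -[k|] //=; apply: contra iN => /eqP E.
by rewrite -(retract_Some E) /= !imset_f.
Qed.

(** Apply the degree condition on T with an added point to the set S with that
    point adjoined. Subsets without the new point give the terms chi(f+); those
    with it factor through T and give the terms chi(f), with opposite sign. *)
Lemma trace_like_difference D (chi : endo_stat) :
  trace_like D.+1 chi ->
  trace_like D (fun T f => chi (option T) (omap f) - chi T f).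
Proof.
move=> chiP; split.
- move=> T f g fg; congr (_ - _); apply: (chi_ext chiP) => //.
  exact: eq_omap.
- move=> T U f g; congr (_ - _); last exact: (chi_comm chiP).
  transitivity (chi (option U) (omap f \o omap g)).
    by apply: (chi_ext chiP) => -[].
  by rewrite (chi_comm chiP); apply: (chi_ext chiP) => -[].
move=> T f S x xS DS.
have Some_inj' : injective (@Some T) by apply: Some_inj.
have None_notin (A : {set T}) : None \notin Some @: A by apply/imsetP => -[].
have xS' : Some x \notin None |: Some @: S by rewrite !inE /= mem_imset.
have cardS' : (D.+1 <= #|None |: Some @: S|)%N.
  by rewrite cardsU1 None_notin card_imset.
rewrite -[RHS](chi_vanish chiP (omap f) xS' cardS').
rewrite sum_subsets_setU1 // sum_subsets_imset //; apply: eq_bigr => A AS.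
rewrite cardsU1 None_notin card_imset // exprS mulN1r mulNr -mulrBr; congr (_ * (_ - _)).
  apply: (chi_ext chiP) => -[t|] //=; rewrite /collapse.
    by rewrite mem_imset //; case: ifP.
  by rewrite (negPf (None_notin A)).
(* Collapsing the added point to x retracts onto T. *)
pose h := f \o collapse A x.
rewrite -[chi T _]/(chi T ((h \o odflt x) \o Some)).
rewrite (chi_comm chiP (h \o odflt x) Some); apply: (chi_ext chiP) => -[t|]; rewrite /h /collapse /=.
  by rewrite !inE /= mem_imset //; case: ifP.
by rewrite !inE /=; case: ifP.
Qed.

Lemma trace_like_fix_poly D chi : trace_like D chi -> fix_poly chi.
Proof.
elim: D chi => [|D IH] chi chiP.
  apply: FixPolyEq (FixPolyConst 0) => T f /card_gt0P[x _].
  have := chi_vanish chiP f (S := set0) (x := x).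
  rewrite inE => /(_ isT isT); rewrite (big_pred1 set0) => [|A]; last by rewrite subset0.
  rewrite cards0 mul1r => <-; apply: (chi_ext chiP) => t.
  by rewrite /= /collapse inE.
apply: (@FixPolyEq (fun T f =>
  \sum_(j < D.+1) (j`!)%:R^-1 *
     \sum_(tau : 'S_j) weight chi (omap tau) * #|embeddings tau f|%:R +
  (-1) * (chi (option T) (omap f) - chi T f))).
  by move=> T f _; rewrite (chi_omap f chiP) mulN1r opprB addrC subrK.
apply: FixPolyAdd; last first.
  by apply: FixPolyMul; [exact: FixPolyConst | exact: IH (trace_like_difference chiP)].
apply: fix_poly_sum => j _; apply: FixPolyMul; first exact: FixPolyConst.
apply: fix_poly_sum => tau _; apply: FixPolyMul; first exact: FixPolyConst.
exact: fix_poly_embeddings.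
Qed.

(** * Traces of finitely generated representations *)

Lemma lfun_trace_comm (U W : vectType rat) (f : 'Hom(U, W)) (g : 'Hom(W, U)) :
  lfun_trace (f \o g)%VF = lfun_trace (g \o f)%VF.
Proof.
rewrite /lfun_trace (mxof_comp _ _ (vbasisP {:U})).
by rewrite (mxof_comp _ _ (vbasisP {:W})) mxtrace_mulC.
Qed.

Lemma lfun_trace_sum (U : vectType rat) (I : finType) (P : pred I) (c : I -> rat)
    (h : I -> 'End(U)) :
  lfun_trace (\sum_(i | P i) c i *: h i) = \sum_(i | P i) c i * lfun_trace (h i).
Proof.
rewrite /lfun_trace linear_sum raddf_sum; apply: eq_bigr => i _.
by rewrite linearZ /= mxtraceZ.
Qed.

Section Annihilation.
Variables (I : finType) (P : pred I) (c : I -> rat) (m n : nat) (phi : I -> fhom m n).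

Definition Fcomb (V : Frep) : 'Hom(V m, V n) := \sum_(i | P i) c i *: Fmap V (phi i).

Lemma Fcomb_tens k :
  (forall g : fhom k m,
     \sum_(i | P i) c i *: tens_basis (fcomp (phi i) g) = 0 :> tens_obj k n) ->
  Fcomb (tens k) = 0.
Proof.
move=> basis0; apply/lfunP => v; rewrite sum_lfunE zero_lfunE.
transitivity (\sum_(g : fhom k m) v g *:
   \sum_(i | P i) c i *: tens_basis (fcomp (phi i) g)); last first.
  by apply: big1 => g _; rewrite basis0 scaler0.
rewrite (eq_bigr (fun i => \sum_(g : fhom k m) c i *: (v g *: tens_basis (fcomp (phi i) g)))).
  rewrite exchange_big /=; apply: eq_bigr => g _.
  by rewrite scaler_sumr; apply: eq_bigr => i _; rewrite !scalerA mulrC.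
by move=> i _; rewrite scale_lfunE lfunE /= /tens_fun scaler_sumr.
Qed.

Lemma Fcomb_dsum V W : Fcomb V = 0 -> Fcomb W = 0 -> Fcomb (dsum V W) = 0.
Proof.
move=> V0 W0; apply/lfunP => -[v w]; rewrite zero_lfunE.
transitivity (Fcomb V v, Fcomb W w); last by rewrite V0 W0 !zero_lfunE.
rewrite /Fcomb !sum_lfunE.
transitivity (\sum_(i | P i) (c i *: Fmap V (phi i) v, c i *: Fmap W (phi i) w)).
  by apply: eq_bigr => i _; rewrite scale_lfunE lfunE.
under [X in (X, _)]eq_bigr do rewrite scale_lfunE.
under [X in (_, X)]eq_bigr do rewrite scale_lfunE.
by elim/big_rec3: _ => // i x y z _ ->.
Qed.

Lemma Fcomb_dsum_tens ks :
  (forall k, k \in ks -> Fcomb (tens k) = 0) -> Fcomb (dsum_tens ks) = 0.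
Proof.
elim: ks => [|k ks IH] ks0 /=.
  by apply/lfunP => v; apply/rowP => -[].
apply: Fcomb_dsum; first by rewrite ks0 ?mem_head.
by apply: IH => l l_ks; rewrite ks0 // inE l_ks orbT.
Qed.

(** Linear relations between the maps induced by functions pass to quotients. *)
Lemma Fcomb_surj (V W : Frep) (eta : forall p, 'Hom(W p, V p)) :
  natural eta -> limg (eta m) = fullv -> Fcomb W = 0 -> Fcomb V = 0.
Proof.
move=> eta_nat eta_surj W0; apply/lfunP => v; rewrite zero_lfunE.
have /memv_imgP[w _ ->] : v \in limg (eta m) by rewrite eta_surj memvf.
transitivity (eta n (Fcomb W w)); last by rewrite W0 zero_lfunE linear0.
rewrite /Fcomb !sum_lfunE linear_sum; apply: eq_bigr => i _.
rewrite !scale_lfunE linearZ /=; congr (_ *: _).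
by rewrite -!comp_lfunE eta_nat.
Qed.

End Annihilation.

(** A representation is evaluated only at the sets [n]; numbering the elements
    extends it to all finite sets. *)
Definition Ford (T U : finType) (f : T -> U) : fhom #|T| #|U| :=
  [ffun i => enum_rank (f (enum_val i))].

Lemma Fmap_Ford_comp (V : Frep) (T U W : finType) (g : U -> W) (f : T -> U) :
  (Fmap V (Ford g) \o Fmap V (Ford f))%VF = Fmap V (Ford (g \o f)).
Proof.
rewrite -Fmap_comp; congr Fmap; apply/ffunP => i.
by rewrite !ffunE enum_rankK.
Qed.

Definition rep_trace (V : Frep) : endo_stat := fun T f => lfun_trace (Fmap V (Ford f)).

Lemma rep_traceE V n (f : fhom n n) : rep_trace V f = lfun_trace (Fmap V f).
Proof.
pose r : fhom n #|'I_n| := [ffun i => enum_rank i].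
pose v : fhom #|'I_n| n := [ffun i => enum_val i].
rewrite /rep_trace (_ : Ford f = fcomp r (fcomp f v)); last first.
  by apply/ffunP => i; rewrite !ffunE.
rewrite Fmap_comp lfun_trace_comm -Fmap_comp; congr (lfun_trace (Fmap V _)).
by apply/ffunP => i; rewrite !ffunE enum_rankK.
Qed.

(** A function from [k] to T misses a point of S once S has more than k
    elements, which makes the alternating sum vanish on basis vectors. *)
Lemma finitely_generated_trace_like V :
  finitely_generated V -> exists D, trace_like D (rep_trace V).
Proof.
case=> ks [eta [eta_nat eta_surj]]; exists (\max_(k <- ks) k).+1; split.
- move=> T f g fg; congr (lfun_trace (Fmap V _)).
  by apply/ffunP => i; rewrite !ffunE fg.
- by move=> T U f g; rewrite /rep_trace -(Fmap_Ford_comp V f g) -(Fmap_Ford_comp V g f) lfun_trace_comm.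
move=> T f S x xS kS; rewrite -lfun_trace_sum.
rewrite -[\sum_(_ | _) _]/(Fcomb (fun A : {set T} => A \subset S)
  (fun A => (-1) ^+ #|A|) (fun A => Ford (f \o collapse A x)) V).
rewrite (Fcomb_surj eta_nat (eta_surj _)).
  by rewrite /lfun_trace linear0 mxtrace0.
apply: Fcomb_dsum_tens => k k_ks; apply: Fcomb_tens => g.
have [s sS s_notin] : exists2 s, s \in S & forall i, enum_val (g i) != s.
  have /subsetPn[s sS sN] : ~~ (S \subset (fun i => enum_val (g i)) @: [set: 'I_k]).
    apply: contraTN kS => /subset_leq_card Sk; rewrite -leqNgt (leq_trans Sk) //.
    apply: leq_trans (leq_imset_card _ _) _; rewrite cardsT card_ord.
    exact: leq_bigmax_seq.
  by exists s => // i; apply: contraNneq sN => <-; apply/imsetP; exists i.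
apply/ffunP => h; rewrite sum_ffunE [RHS]ffunE.
rewrite -[RHS](@alt_sum_eq0 _ s S
  (fun A => tens_basis (fcomp (Ford (f \o collapse A x)) g) h)) //.
  by apply: eq_bigr => A _; rewrite ffunE.
move=> A _; congr (tens_basis _ h); apply/ffunP => i.
by rewrite !ffunE /= /collapse !inE (negPf (s_notin i)).
Qed.

Theorem corollary5p9 (V : Frep) (hV : finitely_generated V) :
  exists (N : nat) (phi : {mpoly rat[N.+1]}),
    forall (n : nat) (f : {ffun 'I_n -> 'I_n}), (0 < n)%N ->
      lfun_trace (Fmap V f) =
      phi.@[fun i : 'I_N.+1 =>
              if val i == 0%N then n%:R else (nfix_iter f i)%:R].
Proof.
have [D /trace_like_fix_poly/fix_poly_mpoly[N /(_ N (leqnn N))[phi phiE]]] :=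
  finitely_generated_trace_like hV.
by exists N, phi => n f n0; rewrite -rep_traceE phiE.
Qed.
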